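(* Let $A$ be a unital Banach algebra with unit $e$ and let $a,b,c\in A$ be such that $a^{\dag}$ exists, $a=bc$, $b^{-1}(0)=0$ and $cA=A$. Then the following statements are equivalent: (i) $a$ is EP; (ii) $bb^{\dag}=c^{\dag}c$; (iii) $(b^{\dag})^{-1}(0)=c^{-1}(0)$; (iv) $bA=c^{\dag}A$; (v) $b_{-1}(0)=(c^{\dag})_{-1}(0)$; (vi) $Ac=Ab^{\dag}$; (vii) $(e-c^{\dag}c)b=0$ and $c(e-bb^{\dag})=0$; (viii) $b^{\dag}(e-c^{\dag}c)=0$ and $c(e-bb^{\dag})=0$; (ix) $(e-c^{\dag}c)b=0$ and $(e-bb^{\dag})c^{\dag}=0$; (x) $b^{\dag}(e-c^{\dag}c)=0$ and $(e-bb^{\dag})c^{\dag}=0$; (xi) $c(e-bb^{\dag})=0$ and $b^{\dag}(e-c^{\dag}c)b=0$; (xii) $b^{\dag}(e-c^{\dag}c)=0$ and $c(e-bb^{\dag})c^{\dag}=0$; (xiii) there exists $x\in A^{-1}$ such that $c=xb^{\dag}$; (xiv) there exists $y\in A$ such that $y^{-1}(0)=0$ and $c=yb^{\dag}$; (xv) there exist $z_1,z_2\in A$ such that $c=z_1b^{\dag}$ and $b^{\dag}=z_2c$; (xvi) there exists $u\in A^{-1}$ such that $b=c^{\dag}u$; (xvii) there exists $v\in A$ such that $vA=A$ and $b=c^{\dag}v$; (xviii) there exist $w_1,w_2\in A$ such that $b=c^{\dag}w_1$ and $c^{\dag}=bw_2$; (xix) there exist $h_1,h_2\in A$ such that $b=c^{\dag}h_2$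 and $c=h_1b^{\dag}$; (xx) there exist $k_1,k_2\in A$ such that $c^{\dag}=bk_2$ and $b^{\dag}=k_1c$; (xxi) there exists $s_1\in A$ such that $s_1^{-1}(0)=0$ and $b^{\dag}=s_1c$; (xxii) there exists $s_2\in A$ such that $s_2A=A$ and $c^{\dag}=bs_2$; (xxiii) $bA^{-1}=c^{\dag}A^{-1}$; (xxiv) $A^{-1}c=A^{-1}b^{\dag}$; (xxv) $a\in c^{\dag}A\cap Ab^{\dag}$; (xxvi) $a^{\dag}\in bA\cap Ac$.
   Context: $A$ is a complex unital Banach algebra; $A^{-1}$ is its set of invertible elements. For $x\in A$: $x^{-1}(0)=\{y\in A: xy=0\}$, $x_{-1}(0)=\{y\in A: yx=0\}$, $xA=\{xy:y\in A\}$, $Ax=\{yx:y\in A\}$; also $xA^{-1}=\{xy:y\in A^{-1}\}$ and $A^{-1}x=\{yx:y\in A^{-1}\}$. An element $h\in A$ is hermitian if $\|\exp(ith)\|=1$ for all $t\in\mathbb{R}$. The Moore-Penrose inverse of $a\in A$, if it exists, is the (unique) $x\in A$ with $a=axa$, $x=xax$ and $ax$, $xa$ hermitian; it is denoted $a^{\dag}$. An element $a$ is EP if $a^{\dag}$ exists and $aa^{\dag}=a^{\dag}a$. Under the hypotheses of the claim, the Moore-Penrose inverses $b^{\dag}$ and $c^{\dag}$ exist in $A$. *)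

(* Defs.v *)
From HB Require Import structures.
From mathcomp Require Import all_boot all_order all_algebra complex.
From mathcomp Require Import boolp classical_sets reals topology normedtype.
From mathcomp Require Import sequences.

Set Implicit Arguments.
Unset Strict Implicit.
Unset Printing Implicit Defensive.

Import Order.TTheory GRing.Theory Num.Theory.
Import numFieldNormedType.Exports.

Local Open Scope classical_set_scope.
Local Open Scope complex_scope.
Local Open Scope ring_scope.

(* HB rejects a structure joining CompleteNormedModule and GRing.Algebra, because
   NumDomain is already a common instance of their ancestors.  The product is
   therefore part of the mixin, and the GRing.Algebra structure is derived from
   it below.
   The condition `|1| = 1 is not required: it is the instance t = 0 of
   hermiticity, hence holds as soon as some element has a Moore-Penrose
   inverse. *)
HB.mixin Record isBanachAlgebra (K : numFieldType) A
    of CompleteNormedModule K A := {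
  bone : A;
  bmul : A -> A -> A;
  bmulA : associative bmul;
  bmul1l : left_id bone bmul;
  bmul1r : right_id bone bmul;
  bmulDl : left_distributive bmul +%R;
  bmulDr : right_distributive bmul +%R;
  bone_neq0 : bone != 0;
  bscaleAl : forall (k : K) (x y : A), k *: bmul x y = bmul (k *: x) y;
  bscaleAr : forall (k : K) (x y : A), k *: bmul x y = bmul x (k *: y);
  bnormM_le : forall x y : A, `|bmul x y| <= `|x| * `|y|
}.

#[short(type="banachAlgType")]
HB.structure Definition BanachAlgebra (K : numFieldType) :=
  {A of CompleteNormedModule K A & isBanachAlgebra K A}.

Section BanachAlgebraAlgebra.
Variables (K : numFieldType) (A : banachAlgType K).

#[non_forgetful_inheritance]
HB.instance Definition _ := GRing.Zmodule_isNzRing.Build A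
  (@bmulA K A) bmul1l bmul1r bmulDl bmulDr bone_neq0.
#[non_forgetful_inheritance]
HB.instance Definition _ := GRing.Lmodule_isLalgebra.Build K A (@bscaleAl K A).
#[non_forgetful_inheritance]
HB.instance Definition _ := GRing.Lalgebra_isAlgebra.Build K A (@bscaleAr K A).

Lemma normrM_le (x y : A) : `|x * y| <= `|x| * `|y|.
Proof. exact: bnormM_le. Qed.

End BanachAlgebraAlgebra.

Section BanachAlgebraNotions.
Context {K : numFieldType} {A : banachAlgType K}.
Implicit Types x : A.

Definition invertible : set A := [set x | exists y, x * y = 1 /\ y * x = 1].

(* x^{-1}(0) and x_{-1}(0) *)
Definition annr x : set A := [set y | x * y = 0].
Definition annl x : set A := [set y | y * x = 0].

(* lmulset x S = xS and rmulset S x = Sx *)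
Definition lmulset x (S : set A) : set A := [set x * y | y in S].
Definition rmulset (S : set A) x : set A := [set y * x | y in S].

Definition bexp x : A := limn (series (fun n => (n`!%:R : K)^-1 *: x ^+ n)).

End BanachAlgebraNotions.

Section MoorePenrose.
Context {R : realType} {A : banachAlgType R[i]}.
Implicit Types a x h : A.

Definition hermitian h : Prop :=
  forall t : R, `|bexp ((0 +i* t) *: h)| = 1.

Definition is_MP_inverse a x : Prop :=
  [/\ a = a * x * a, x = x * a * x, hermitian (a * x) & hermitian (x * a)].

Definition MP_invertible a : Prop := exists x, is_MP_inverse a x.

(* Meaningful only when MP_invertible a; the default value is 0. *)
Definition MP_inverse a : A := xget 0 [set x | is_MP_inverse a x].

Definition EP a : Prop :=
  MP_invertible a /\ a * MP_inverse a = MP_inverse a * a.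

End MoorePenrose.

Notation "a ^dag" := (MP_inverse a) (at level 2, format "a ^dag") : ring_scope.

(* Main.v *)
(* Cancelling [b] on the left and [c] on the right of [a = a a^dag a] gives
   [c a^dag b = 1], so [b^dag = c a^dag] and [c^dag = a^dag b], with
   [b b^dag = a a^dag] and [c^dag c = a^dag a].  Being EP thus means that the
   hermitian idempotents [p = b b^dag] and [q = c^dag c] coincide.

   Each of the other conditions yields [p = q] through one of the pairs
   [p q = p, q p = q] (same left ideal), [p q = q, q p = p] (same right ideal)
   or [q p = p = q], [p q = p = q].  In the first two cases one uses that
   [exp (i pi p) = 1 - 2 p] has norm 1: the product of the reflections attached
   to [p] and [q] is [1 + r] with [r = 2 (q - p)] of square zero, and
   [(1 + r)^n = 1 + n r] stays in the unit ball only if [r = 0].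

   Conversely, if [p = q], then [c b] is invertible with inverse
   [b^dag c^dag], and these two elements witness every factorization. *)
Require Import Defs.
From mathcomp Require Import all_boot all_order all_algebra complex.
From mathcomp Require Import boolp classical_sets reals topology normedtype.
From mathcomp Require Import sequences trigo.

Import Order.TTheory GRing.Theory Num.Theory.
Import numFieldNormedType.Exports.

Local Open Scope classical_set_scope.
Local Open Scope complex_scope.
Local Open Scope ring_scope.

(** * Euler's formula for the exponential series in [R[i]] *)

Section ComplexExponential.
Context {R : realType}.
Implicit Type t : R.

(** A positive element of [R[i]] is real and the embedding of [R] preserves absolute values, so the
    same epsilon serves on both sides. *)
Lemma cvg_real_complex {T : Type} {F : set_system T} {FF : Filter F}
    (f : T -> R) (l : R) :
  f @ F --> l -> (fun x => (f x)%:C : (R[i])^o) @ F --> (l%:C : (R[i])^o).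
Proof.
move=> /cvgrPdist_lt fl; apply/(@cvgrPdist_lt _ (R[i])^o) => -[e e'].
rewrite ltcE /= => /andP[/eqP -> e0].
apply: filterS (fl e e0) => x; rewrite -rmorphB /= normc_def /= expr0n /= addr0.
by rewrite sqrtr_sqr ltcR.
Qed.

Lemma expi_coeffE t n :
  (n`!%:R : R[i])^-1 * (0 +i* t) ^+ n
  = (cos_coeff t n)%:C + 'i * (sin_coeff t n)%:C.
Proof.
have -> : (0 +i* t) = 'i * t%:C by rewrite [LHS]complexE add0r.
rewrite exprMn mulrCA -rmorphXn /=.
have -> : ('i : R[i]) ^+ n = ((~~ odd n)%:R * (-1) ^+ n./2)%:C
                  + 'i * ((odd n)%:R * (-1) ^+ n.-1./2)%:C.
  rewrite -{1}(odd_double_half n) exprD -mul2n exprM sqr_i.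
  case: (boolP (odd n)) => [n_odd|_].
    (* The sine coefficients are indexed by [n.-1./2], which agrees with [n./2] for odd [n]. *)
    have -> : n.-1./2 = n./2.
      by case: n n_odd => //= n; rewrite uphalf_half => /negPf->.
    by rewrite mul0r mul1r rmorph0 add0r expr1 rmorphXn rmorphN1.
  by rewrite /= mul0r mul1r rmorph0 mulr0 addr0 mul1r rmorphXn rmorphN1.
rewrite cos_coeffE sin_coeffE -(rmorph_nat (real_complex R)) -fmorphV.
by rewrite !(rmorphM (real_complex R)) !mulrA -!mulrDl.
Qed.

Lemma norm_cosDisin t : `|cos t +i* sin t| = 1.
Proof. by rewrite normc_def /= cos2Dsin2 sqrtr1. Qed.

(** The order of [R[i]] forces [x] to be real, and the real part of [M] bounds its multiples, so the
    Archimedean property of [R] applies. *)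
Lemma mulrn_bounded_eq0 (x M : R[i]) :
  0 <= x -> (forall n, x *+ n <= M) -> x = 0.
Proof.
case: x => x y; rewrite lecE /= => /andP[/eqP -> x_ge0] xn_le.
have [->//|x_neq0] := eqVneq x 0.
have x_gt0 : 0 < x by rewrite lt_neqAle eq_sym x_neq0.
have M_ge0 : 0 <= complex.Re M.
  by have := xn_le 0%N; rewrite mulr0n lecE => /andP[].
have := xn_le (Num.Def.archi_bound (complex.Re M / x)).
rewrite -(rmorphMn (real_complex R)) lecE /= leNgt -mulr_natr => /andP[_].
by rewrite -ltr_pdivrMl // mulrC archi_boundP // divr_ge0 // ltW.
Qed.

Lemma cvg_series_expi t :
  series (fun n => (n`!%:R : R[i])^-1 * (0 +i* t) ^+ n) @ \oo
    --> (cos t +i* sin t : (R[i])^o).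
Proof.
have -> : series (fun n => (n`!%:R : R[i])^-1 * (0 +i* t) ^+ n)
  = (fun n => (series (cos_coeff t) n)%:C
            + 'i * (series (sin_coeff t) n)%:C).
  apply/funext => n; rewrite !rmorph_sum mulr_sumr -big_split.
  by apply: eq_bigr => k _; exact: expi_coeffE.
rewrite [X in _ --> X]complexE /=; apply: (@cvgD R[i] (R[i])^o).
  apply: cvg_real_complex; rewrite cos.unlock.
  exact: is_cvg_series_cos_coeff.
apply: (@cvgZl_tmp (R[i]) (R[i])^o nat \oo _ _
  (fun n => (series (sin_coeff t) n)%:C)).
apply: cvg_real_complex; rewrite sin.unlock.
exact: is_cvg_series_sin_coeff.
Qed.

End ComplexExponential.

(** * Hermitian idempotents and their reflections *)

Section Hermitian.
Context {R : realType} {A : banachAlgType R[i]}.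
Implicit Types p q x y : A.

(** All positive powers of [p] equal [p]; splitting the constant term as [1 = (1 - p) + p] leaves
    the scalar series of [exp (i t)] times [p]. The index shift keeps the constant term in every
    partial sum. *)
Lemma bexp_idempotent (t : R) p : p * p = p ->
  bexp ((0 +i* t) *: p) = 1 - p + (cos t +i* sin t) *: p.
Proof.
move=> pp; apply: norm_cvg_lim; rewrite -cvg_shiftS.
have pX n : p ^+ n.+1 = p.
  by elim: n => [|n ih]; rewrite ?expr1 // exprS ih.
have -> : (fun n => series (fun k => (k`!%:R : R[i])^-1
                              *: ((0 +i* t) *: p) ^+ k) n.+1)
  = (fun n => 1 - p +
      series (fun k => (k`!%:R : R[i])^-1 * (0 +i* t) ^+ k) n.+1 *: p).
  apply/funext => n; rewrite !seriesEnat /= !big_nat_recl //.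
  rewrite !expr0 fact0 invr1 mulr1 scale1r scalerDl scale1r addrA subrK.
  congr (_ + _); rewrite scaler_suml; apply: eq_bigr => k _.
  by rewrite exprZn pX scalerA.
apply: cvgD; first exact: cvg_cst.
apply: cvgZr_tmp; have := cvg_series_expi t.
by rewrite -(@cvg_shiftS (R[i])^o).
Qed.

Lemma hermitian_idempotent_reflection p : p * p = p -> Defs.hermitian p ->
  `|1 - p *+ 2| = 1.
Proof.
move=> pp /(_ pi); rewrite bexp_idempotent // cospi sinpi.
have -> : ((-1) +i* 0 : R[i]) = -1 by rewrite complexr0 rmorphN1.
by rewrite scaleN1r -addrA -opprD -mulr2n.
Qed.

(** Taking [t = 0] for [x] gives norm 1 for the unit, and [exp (i t 1)] is the unit times a scalar
    of modulus 1. *)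
Lemma hermitian1 x : Defs.hermitian x -> Defs.hermitian (1 : A).
Proof.
move=> /(_ 0); have -> : (0 +i* 0 : R[i]) *: x = (0 +i* 0) *: 0.
  by rewrite scaler0 [_ +i* _]complexr0 scale0r.
rewrite bexp_idempotent ?mulr0 // scaler0 subr0 addr0 => norm1 t.
by rewrite bexp_idempotent ?mulr1 // subrr add0r normrZ norm_cosDisin norm1 mulr1.
Qed.

Lemma square_zero_eq0 (r : A) : r * r = 0 -> `|1 + r| <= 1 -> r = 0.
Proof.
move=> rr le1.
have powE n : (1 + r) ^+ n = 1 + r *+ n.
  elim: n => [|n ih]; first by rewrite expr0 mulr0n addr0.
  rewrite exprS ih mulrDl mul1r mulrDr mulr1 mulrnAr rr mul0rn addr0.
  by rewrite mulrS addrAC addrA.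
have pow_le1 n : `|(1 + r) ^+ n.+1| <= 1.
  elim: n => [|n ih]; first by rewrite expr1.
  by rewrite exprS (le_trans (normrM_le _ _)) // mulr_ile1.
(* The bound comes from [r *+ n = (1 + r) ^+ n - 1]. The case [n = 0] is separate because the norm
   of the unit is not known to be at most 1 here. *)
apply: normr0_eq0; apply: (@mulrn_bounded_eq0 _ _ (1 + `|1 : A|)) => // -[|n].
  by rewrite mulr0n addr_ge0.
rewrite -normrMn -[_ *+ _](addKr 1) addrC -powE.
by rewrite (le_trans (ler_normB _ _)) // lerD2r.
Qed.

Lemma hermitian_idempotents_eq p q : Defs.hermitian p -> Defs.hermitian q ->
  p * p = p -> q * q = q ->
  (p * q = q /\ q * p = p) \/ (p * q = p /\ q * p = q) -> p = q.
Proof.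
move=> hp hq pp qq pqE.
have rr : (q - p) * (q - p) = 0.
  rewrite mulrBl !mulrBr pp qq.
  by case: pqE => -[-> ->]; rewrite opprB ?subrr ?addr0 // addrC subrKA subrr.
have : (q - p) *+ 2 = 0.
  apply: square_zero_eq0; first by rewrite mulrnAl mulrnAr rr !mul0rn.
  have reflection_le1 : `|1 - p *+ 2| <= 1 /\ `|1 - q *+ 2| <= 1.
    by rewrite !hermitian_idempotent_reflection.
  (* The order of the two reflections is chosen so that the cross term, [p * q] or [q * p], equals
     [q]. *)
  case: pqE reflection_le1 => [] [pqE qpE] [np nq].
    have -> : 1 + (q - p) *+ 2 = (1 - p *+ 2) * (1 - q *+ 2).
      rewrite mulrBl mul1r mulrBr mulr1 mulrnAl mulrnAr pqE.
      by rewrite [_ *+ 2 *+ 2]mulr2n opprB mulrnBl 2![in RHS]addrA subrK addrA.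
    by rewrite (le_trans (normrM_le _ _)) // mulr_ile1.
  have -> : 1 + (q - p) *+ 2 = (1 - q *+ 2) * (1 - p *+ 2).
    rewrite mulrBl mul1r mulrBr mulr1 mulrnAl mulrnAr qpE.
    by rewrite [_ *+ 2 *+ 2]mulr2n opprB addrK mulrnBl [RHS]addrAC addrA.
  by rewrite (le_trans (normrM_le _ _)) // mulr_ile1.
rewrite -scaler_nat => /eqP; rewrite scaler_eq0 pnatr_eq0 /=.
by rewrite subr_eq0 => /eqP.
Qed.

End Hermitian.

(** * Uniqueness of the Moore-Penrose inverse *)

Section MoorePenrose.
Context {R : realType} {A : banachAlgType R[i]}.
Implicit Types a x y : A.

(** The hermitian idempotents [a * x] and [a * y] generate the same right ideal, [x * a] and [y * a]
    the same left ideal, so they coincide in pairs; then [x = x a x = x a y = y a y = y]. *)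
Lemma is_MP_inverse_unique a x y :
  is_MP_inverse a x -> is_MP_inverse a y -> x = y.
Proof.
move=> [axa xax hax hxa] [aya yay hay hya].
have idem (u v : A) : u = u * v * u -> (u * v) * (u * v) = u * v.
  by move=> e; rewrite mulrA -e.
have ax_ay : a * x = a * y.
  apply: (hermitian_idempotents_eq _ _ hax hay (idem _ _ axa) (idem _ _ aya) _).
  by left; rewrite !mulrA -axa -aya.
have xa_ya : x * a = y * a.
  apply: (hermitian_idempotents_eq _ _ hxa hya (idem _ _ xax) (idem _ _ yay) _).
  by right; rewrite -!mulrA ![a * (_ * a)]mulrA -axa -aya.
by rewrite xax -mulrA ax_ay mulrA xa_ya -yay.
Qed.

Lemma MP_inverseP a : MP_invertible a -> is_MP_inverse a a^dag.
Proof.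
by move=> [x ax]; apply: (@xgetPex _ 0 [set x | is_MP_inverse a x]); exists x.
Qed.

Lemma MP_inverseE a x : is_MP_inverse a x -> a^dag = x.
Proof.
move=> ax; apply: (is_MP_inverse_unique a _ _ _ ax).
by apply: MP_inverseP; exists x.
Qed.

End MoorePenrose.

(** * Annihilators, one-sided ideals and units *)

Section Invertible.
Context {K : numFieldType} {A : banachAlgType K}.
Implicit Types u x y : A.

Lemma annr_invertible u : invertible u -> annr u = [set 0].
Proof.
move=> [v [_ vu]]; apply/seteqP; split=> x /= => [ux|->]; last exact: mulr0.
by rewrite -[x]mul1r -vu -mulrA ux mulr0.
Qed.

Lemma annrM_inj u x : annr u = [set 0] -> annr (u * x) = annr x.
Proof.
move=> u_inj; apply/seteqP; split=> y; rewrite /annr /= -mulrA.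
  by move=> uxy; have : annr u (x * y) by []; rewrite u_inj.
by move=> ->; rewrite mulr0.
Qed.

Lemma annlM_surj u x : lmulset u setT = setT -> annl (x * u) = annl x.
Proof.
move=> u_surj; have [v _ uv] : lmulset u setT 1 by rewrite u_surj.
apply/seteqP; split=> y; rewrite /annl /= mulrA; last by move=> ->; rewrite mul0r.
by move=> yxu; rewrite -[_ * x]mulr1 -uv mulrA yxu mul0r.
Qed.

Lemma lmulsetM x y (S : set A) : lmulset (x * y) S = lmulset x (lmulset y S).
Proof.
apply/seteqP; split=> [_ [z Sz <-]|_ [_ [z Sz <-] <-]].
  by exists (y * z); [exists z|rewrite mulrA].
by exists z; rewrite ?mulrA.
Qed.

Lemma rmulsetM x y (S : set A) : rmulset S (x * y) = rmulset (rmulset S x) y.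
Proof.
apply/seteqP; split=> [_ [z Sz <-]|_ [_ [z Sz <-] <-]].
  by exists (z * x); [exists z|rewrite mulrA].
by exists z; rewrite ?mulrA.
Qed.

Lemma invertible1 : invertible (1 : A).
Proof. by exists 1; rewrite mulr1. Qed.

Lemma invertibleM x y : invertible x -> invertible y -> invertible (x * y).
Proof.
move=> [x' [xx' x'x]] [y' [yy' y'y]]; exists (y' * x'); split.
  by rewrite mulrA -[_ * y * _]mulrA yy' mulr1.
by rewrite mulrA -[_ * x' * _]mulrA x'x mulr1.
Qed.

Lemma lmulset_invertible_setT u : invertible u -> lmulset u setT = setT.
Proof.
move=> [v [uv _]]; apply/seteqP; split=> // x _.
by exists (v * x); rewrite // mulrA uv mul1r.
Qed.

Lemma rmulset_invertible_setT u : invertible u -> rmulset setT u = setT.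
Proof.
move=> [v [_ vu]]; apply/seteqP; split=> // x _.
by exists (x * v); rewrite // -mulrA vu mulr1.
Qed.

Lemma lmulset_invertible u : invertible u -> lmulset u invertible = invertible.
Proof.
move=> u_inv; apply/seteqP; split=> [_ [x x_inv <-]|x x_inv].
  exact: invertibleM.
have [v [uv vu]] := u_inv; exists (v * x); last by rewrite mulrA uv mul1r.
by apply: invertibleM => //; exists u.
Qed.

Lemma rmulset_invertible u : invertible u -> rmulset invertible u = invertible.
Proof.
move=> u_inv; apply/seteqP; split=> [_ [x x_inv <-]|x x_inv].
  exact: invertibleM.
have [v [uv vu]] := u_inv; exists (x * v); last by rewrite -mulrA vu mulr1.
by apply: invertibleM => //; exists u.
Qed.

End Invertible.

(** * Moore-Penrose inverses of the two factors *)

Section Factorization.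
Context {R : realType} {A : banachAlgType R[i]} (a b c : A).
Hypotheses (a_MP : MP_invertible a) (a_bc : a = b * c).
Hypotheses (b_inj : annr b = [set 0]) (c_surj : lmulset c setT = setT).

Lemma factor_MP_inverses :
  [/\ is_MP_inverse b (c * a^dag), is_MP_inverse c (a^dag * b),
      c * a^dag * b = 1 & c * (a^dag * b) = 1].
Proof.
have [aa'a a'aa' h_aa' h_a'a] := MP_inverseP a a_MP.
have [r _ cr] : lmulset c setT 1 by rewrite c_surj.
have b_reg x y : b * x = b * y -> x = y.
  move=> bxy; have : annr b (x - y) by rewrite /annr /= mulrBr bxy subrr.
  by rewrite b_inj => /eqP; rewrite subr_eq0 => /eqP.
have ca'bc : c * a^dag * b * c = c.
  by apply: b_reg; rewrite -mulrA -a_bc !mulrA -a_bc -aa'a.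
have ca'b : c * a^dag * b = 1 by rewrite -[LHS]mulr1 -cr mulrA ca'bc.
have ca'_b : c * (a^dag * b) = 1 by rewrite mulrA.
(* For each factor one of the two products is the unit, whose hermiticity is obtained here; the
   other is [a * a^dag] or [a^dag * a]. *)
have h1 := hermitian1 _ h_aa'.
split=> //.
  split; rewrite ?ca'b ?mul1r //.
    by rewrite -mulrA ca'b mulr1.
  by rewrite mulrA -a_bc.
split; rewrite ?ca'_b ?mul1r //; first by rewrite -mulrA ca'_b mulr1.
by rewrite -mulrA -a_bc.
Qed.

Lemma EP_factorization : EP a <-> b * b^dag = c^dag * c.
Proof.
have [/MP_inverseE b_dag /MP_inverseE c_dag _ _] := factor_MP_inverses.
by rewrite b_dag c_dag mulrA -[_ * b * c]mulrA -a_bc; split=> [[]|].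
Qed.

Lemma MP_inverse_factorization : a^dag = c^dag * b^dag.
Proof.
have [/MP_inverseE b_dag /MP_inverseE c_dag _ _] := factor_MP_inverses.
have [_ a'aa' _ _] := MP_inverseP a a_MP.
by rewrite b_dag c_dag mulrA -[_ * b * c]mulrA -a_bc.
Qed.

Lemma MP_inverse_left_inverse : b^dag * b = 1.
Proof. by have [/MP_inverseE->] := factor_MP_inverses. Qed.

Lemma MP_inverse_right_inverse : c * c^dag = 1.
Proof. by have [_ /MP_inverseE->] := factor_MP_inverses. Qed.

End Factorization.

(** * Comparison of the range projections [p = b b'] and [q = c' c] *)

Lemma defect_l (S : nzRingType) (x y : S) : (1 - x) * y = 0 <-> x * y = y.
Proof.
by rewrite mulrBl mul1r;
split=> [/eqP|->]; rewrite ?subrr // subr_eq0 => /eqP. Qed.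

Lemma defect_r (S : nzRingType) (x y : S) : y * (1 - x) = 0 <-> y * x = y.
Proof.
by rewrite mulrBr mulr1;
split=> [/eqP|->]; rewrite ?subrr // subr_eq0 => /eqP. Qed.

Section RangeProjections.
Context {R : realType} {A : banachAlgType R[i]} (b b' c c' : A).
Hypotheses (b'b : b' * b = 1) (cc' : c * c' = 1).
Hypotheses (h_bb' : Defs.hermitian (b * b')) (h_c'c : Defs.hermitian (c' * c)).

Let pp : b * b' * (b * b') = b * b'.
Proof. by rewrite mulrA -[_ * b' * b]mulrA b'b mulr1. Qed.

Let qq : c' * c * (c' * c) = c' * c.
Proof. by rewrite mulrA -[_ * c * c']mulrA cc' mulr1. Qed.

Lemma proj_eq_of_lideals :
  b' * (1 - c' * c) = 0 -> c * (1 - b * b') = 0 -> b * b' = c' * c.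
Proof.
move=> /defect_r b'q /defect_r cp.
apply: (hermitian_idempotents_eq _ _ h_bb' h_c'c pp qq); right.
by rewrite -!mulrA [b' * _]b'q [c * _]cp.
Qed.

Lemma proj_eq_of_rideals :
  (1 - c' * c) * b = 0 -> (1 - b * b') * c' = 0 -> b * b' = c' * c.
Proof.
move=> /defect_l qb /defect_l pc'.
apply: (hermitian_idempotents_eq _ _ h_bb' h_c'c pp qq); left.
by rewrite !mulrA -[b * b' * c']mulrA -[c' * c * b]mulrA mulrA pc' mulrA qb.
Qed.

(** Both idempotents equal [q p]: [p = (q b) b'] and [q = c' (c p)]. *)
Lemma proj_eq_of_bc :
  (1 - c' * c) * b = 0 -> c * (1 - b * b') = 0 -> b * b' = c' * c.
Proof. by move=> /defect_l qb /defect_r cp; rewrite -{1}qb -{2}cp !mulrA. Qed.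

(** Both idempotents equal [p q]: [p = b (b' q)] and [q = (p c') c]. *)
Lemma proj_eq_of_b'c' :
  b' * (1 - c' * c) = 0 -> (1 - b * b') * c' = 0 -> b * b' = c' * c.
Proof. by move=> /defect_r b'q /defect_l pc'; rewrite -{1}b'q -{2}pc' !mulrA. Qed.

Lemma left_inverse_defects : (1 - b * b') * b = 0 /\ b' * (1 - b * b') = 0.
Proof.
by split; [apply/defect_l; rewrite -mulrA b'b mulr1|
           apply/defect_r; rewrite mulrA b'b mul1r].
Qed.

Lemma right_inverse_defects : (1 - c' * c) * c' = 0 /\ c * (1 - c' * c) = 0.
Proof.
by split; [apply/defect_l; rewrite -mulrA cc' mulr1|
           apply/defect_r; rewrite mulrA cc' mul1r].
Qed.

(** Right multiplication by [p = b b'] fixes [b' (1 - q)], since [b' p = b'] and [c p = c]; so the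
    factor [b] can be cancelled. *)
Lemma cancel_b :
  c * (1 - b * b') = 0 -> b' * (1 - c' * c) * b = 0 -> b' * (1 - c' * c) = 0.
Proof.
move=> /defect_r cp b'qb.
have <- : b' * (1 - c' * c) * (b * b') = b' * (1 - c' * c).
  by rewrite !mulrBr !mulr1 mulrBl -!mulrA cp [b' * (b * b')]mulrA b'b mul1r.
by rewrite mulrA b'qb mul0r.
Qed.

(** Right multiplication by [q = c' c] fixes [c (1 - p)], since [c q = c] and [b' q = b']; so the
    factor [c'] can be cancelled. *)
Lemma cancel_c' :
  b' * (1 - c' * c) = 0 -> c * (1 - b * b') * c' = 0 -> c * (1 - b * b') = 0.
Proof.
move=> /defect_r b'q cpc'.
have <- : c * (1 - b * b') * (c' * c) = c * (1 - b * b').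
  by rewrite !mulrBr !mulr1 mulrBl -!mulrA b'q [c * (c' * c)]mulrA cc' mul1r.
by rewrite mulrA cpc' mul0r.
Qed.

Hypothesis pq : b * b' = c' * c.

Lemma proj_eq_invertible : invertible (c * b) /\ invertible (b' * c').
Proof.
have cbb'c' : c * b * (b' * c') = 1.
  by rewrite mulrA -[c * b * b']mulrA pq mulrA cc' mul1r.
have b'c'cb : b' * c' * (c * b) = 1.
  by rewrite mulrA -[b' * c' * c]mulrA -pq mulrA b'b mul1r.
by split; [exists (b' * c')|exists (c * b)].
Qed.

(** Each element is fixed by one of [p], [q] on the appropriate side; exchanging that idempotent for
    the other gives the factorization. *)
Lemma proj_eq_factorizations :
  [/\ c = c * b * b', b = c' * (c * b), b' = b' * c' * c & c' = b * (b' * c')].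
Proof.
split; first by rewrite -mulrA pq mulrA cc' mul1r.
- by rewrite mulrA -pq -mulrA b'b mulr1.
- by rewrite -mulrA -pq mulrA b'b mul1r.
- by rewrite mulrA pq -mulrA cc' mulr1.
Qed.

End RangeProjections.

(** * The cycle of equivalences *)

Theorem theorem3p7 (R : realType) (A : banachAlgType R[i]) (a b c : A)
    (a_MP : MP_invertible a) (a_bc : a = b * c)
    (b_inj : annr b = [set 0]) (c_surj : lmulset c setT = setT) :
  MP_invertible b /\ MP_invertible c /\
  [<->
    (* i *) EP a;
    (* ii *) b * b^dag = c^dag * c;
    (* iii *) annr b^dag = annr c;
    (* iv *) lmulset b setT = lmulset c^dag setT;
    (* v *) annl b = annl c^dag;
    (* vi *) rmulset setT c = rmulset setT b^dag;
    (* vii *) (1 - c^dag * c) * b = 0 /\ c * (1 - b * b^dag) = 0;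
    (* viii *) b^dag * (1 - c^dag * c) = 0 /\ c * (1 - b * b^dag) = 0;
    (* ix *) (1 - c^dag * c) * b = 0 /\ (1 - b * b^dag) * c^dag = 0;
    (* x *) b^dag * (1 - c^dag * c) = 0 /\ (1 - b * b^dag) * c^dag = 0;
    (* xi *) c * (1 - b * b^dag) = 0 /\ b^dag * (1 - c^dag * c) * b = 0;
    (* xii *) b^dag * (1 - c^dag * c) = 0 /\ c * (1 - b * b^dag) * c^dag = 0;
    (* xiii *) exists x : A, invertible x /\ c = x * b^dag;
    (* xiv *) exists y : A, annr y = [set 0] /\ c = y * b^dag;
    (* xv *) exists z1 z2 : A, c = z1 * b^dag /\ b^dag = z2 * c;
    (* xvi *) exists u : A, invertible u /\ b = c^dag * u;
    (* xvii *) exists v : A, lmulset v setT = setT /\ b = c^dag * v;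
    (* xviii *) exists w1 w2 : A, b = c^dag * w1 /\ c^dag = b * w2;
    (* xix *) exists h1 h2 : A, b = c^dag * h2 /\ c = h1 * b^dag;
    (* xx *) exists k1 k2 : A, c^dag = b * k2 /\ b^dag = k1 * c;
    (* xxi *) exists s1 : A, annr s1 = [set 0] /\ b^dag = s1 * c;
    (* xxii *) exists s2 : A, lmulset s2 setT = setT /\ c^dag = b * s2;
    (* xxiii *) lmulset b invertible = lmulset c^dag invertible;
    (* xxiv *) rmulset invertible c = rmulset invertible b^dag;
    (* xxv *) (lmulset c^dag setT `&` rmulset setT b^dag) a;
    (* xxvi *) (lmulset b setT `&` rmulset setT c) a^dag
  ].
Proof.
have [b_dag c_dag _ _] := factor_MP_inverses a b c a_MP a_bc b_inj c_surj.
split; first by exists (c * a^dag).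
split; first by exists (a^dag * b).
have [_ _ h_bb' _] : is_MP_inverse b b^dag.
  by apply: MP_inverseP; exists (c * a^dag).
have [_ _ _ h_c'c] : is_MP_inverse c c^dag.
  by apply: MP_inverseP; exists (a^dag * b).
have b'b := MP_inverse_left_inverse a b c a_MP a_bc b_inj c_surj.
have cc' := MP_inverse_right_inverse a b c a_MP a_bc b_inj c_surj.
have EPE := EP_factorization a b c a_MP a_bc b_inj c_surj.
have a'E := MP_inverse_factorization a b c a_MP a_bc b_inj c_surj.
(* From here on [b'] and [c'] are known only through the one-sided inverse laws, hermiticity, and
   the two relations to [a]. *)
move: (b^dag) (c^dag) h_bb' h_c'c b'b cc' EPE a'E => {b_dag c_dag} b' c'.
move=> h_bb' h_c'c b'b cc' EPE a'E.
have of_lideals := proj_eq_of_lideals b b' c c' b'b cc' h_bb' h_c'c.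
have of_rideals := proj_eq_of_rideals b b' c c' b'b cc' h_bb' h_c'c.
have of_bc := proj_eq_of_bc b b' c c'.
have of_b'c' := proj_eq_of_b'c' b b' c c'.
have [pb b'p] := left_inverse_defects b b' b'b.
have [qc' cq] := right_inverse_defects c c' cc'.
have inv := proj_eq_invertible b b' c c' b'b cc'.
have fact := proj_eq_factorizations b b' c c' b'b cc'.
(* Each one-sided factorization makes one of the four defects vanish. *)
have qb_fact u : b = c' * u -> (1 - c' * c) * b = 0.
  by move=> ->; rewrite mulrA qc' mul0r.
have pc'_fact u : c' = b * u -> (1 - b * b') * c' = 0.
  by move=> ->; rewrite mulrA pb mul0r.
have cp_fact u : c = u * b' -> c * (1 - b * b') = 0.
  by move=> ->; rewrite -mulrA b'p mulr0.
have b'q_fact u : b' = u * c -> b' * (1 - c' * c) = 0.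
  by move=> ->; rewrite -mulrA cq mulr0.
have defects : b * b' = c' * c ->
    [/\ (1 - c' * c) * b = 0, c * (1 - b * b') = 0,
        b' * (1 - c' * c) = 0 & (1 - b * b') * c' = 0].
  by move=> pq; split; rewrite -?pq // pq.
(* The implications follow the listed order and close up at the end; most pass through [p = q], then
   read off the next condition from [fact], [inv] or [defects]. *)
tfae.
- by move/EPE.
- move=> pq; have [cE _ _ _] := fact pq; have [cb_inv _] := inv pq.
  by rewrite [in RHS]cE annrM_inj // annr_invertible.
- move=> annE.
  have pq : b * b' = c' * c.
    (* The test elements are [1 - q], which [c] kills, and [1 - p], which [b'] kills. *)
    apply: of_lideals.
      by have : annr c (1 - c' * c) by []; rewrite -annE.
    by have : annr b' (1 - b * b') by []; rewrite annE.
  have [_ bE _ _] := fact pq; have [u_inv _] := inv pq.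
  by rewrite [in LHS]bE lmulsetM lmulset_invertible_setT.
- move=> rE.
  have [u _ bE] : lmulset c' setT b by rewrite -rE; exists 1; rewrite ?mulr1.
  have [v _ c'E] : lmulset b setT c' by rewrite rE; exists 1; rewrite ?mulr1.
  have pq := of_rideals (qb_fact _ (esym bE)) (pc'_fact _ (esym c'E)).
  have [_ {}bE _ _] := fact pq; have [u_inv _] := inv pq.
  by rewrite [in LHS]bE annlM_surj // lmulset_invertible_setT.
- move=> annE.
  have pq : b * b' = c' * c.
    apply: of_rideals.
      by have : annl c' (1 - c' * c) by []; rewrite -annE.
    by have : annl b (1 - b * b') by []; rewrite annE.
  have [cE _ _ _] := fact pq; have [u_inv _] := inv pq.
  by rewrite [in LHS]cE rmulsetM rmulset_invertible_setT.
- move=> lE.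
  have [u _ cE] : rmulset setT b' c by rewrite -lE; exists 1; rewrite ?mul1r.
  have [v _ b'E] : rmulset setT c b' by rewrite lE; exists 1; rewrite ?mul1r.
  have pq := of_lideals (b'q_fact _ (esym b'E)) (cp_fact _ (esym cE)).
  by have [] := defects pq.
- by move=> [qb cp]; have [] := defects (of_bc qb cp).
- by move=> [b'q cp]; have [] := defects (of_lideals b'q cp).
- by move=> [qb pc']; have [] := defects (of_rideals qb pc').
- move=> [b'q pc']; have [_ -> -> _] := defects (of_b'c' b'q pc').
  by rewrite mul0r.
- by move=> [cp b'qb]; rewrite (cancel_b _ _ _ _ b'b cp b'qb) cp mul0r.
- move=> [b'q cpc'].
  have pq := of_lideals b'q (cancel_c' _ _ _ _ cc' b'q cpc').
  by have [cE _ _ _] := fact pq; have [cb_inv _] := inv pq; exists (c * b).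
- by move=> [x [x_inv cE]]; exists x; rewrite annr_invertible.
- move=> [y [y_inj cE]].
  (* The equation [c (1 - q) = 0] reads [y b' (1 - q) = 0], and [y] cancels on the left. *)
  have b'q : b' * (1 - c' * c) = 0.
    have : annr (y * b') (1 - c' * c) by rewrite -cE.
    by rewrite annrM_inj.
  have [cE' _ b'E _] := fact (of_lideals b'q (cp_fact _ cE)).
  by exists (c * b), (b' * c').
- move=> [z1 [z2 [/cp_fact cp /b'q_fact b'q]]].
  have pq := of_lideals b'q cp.
  by have [_ bE _ _] := fact pq; have [cb_inv _] := inv pq; exists (c * b).
- by move=> [u [u_inv bE]]; exists u; rewrite lmulset_invertible_setT.
- move=> [v [v_surj bE]].
  (* Dually, [(1 - p) b = 0] reads [(1 - p) c' v = 0], and [v] has a right inverse. *)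
  have pc' : (1 - b * b') * c' = 0.
    have : annl (c' * v) (1 - b * b') by rewrite -bE.
    by rewrite annlM_surj.
  have [_ bE' _ c'E] := fact (of_rideals (qb_fact _ bE) pc').
  by exists (c * b), (b' * c').
- move=> [w1 [w2 [/qb_fact qb /pc'_fact pc']]].
  have [cE bE _ _] := fact (of_rideals qb pc').
  by exists (c * b), (c * b).
- move=> [h1 [h2 [/qb_fact qb /cp_fact cp]]].
  have [_ _ b'E c'E] := fact (of_bc qb cp).
  by exists (b' * c'), (b' * c').
- move=> [k1 [k2 [/pc'_fact pc' /b'q_fact b'q]]].
  have pq := of_b'c' b'q pc'.
  have [_ _ b'E _] := fact pq; have [_ inv'] := inv pq.
  by exists (b' * c'); rewrite annr_invertible.
- move=> [s [s_inj b'E]].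
  have cp : c * (1 - b * b') = 0.
    have : annr (s * c) (1 - b * b') by rewrite -b'E.
    by rewrite annrM_inj.
  have pq := of_lideals (b'q_fact _ b'E) cp.
  have [_ _ _ c'E] := fact pq; have [_ inv'] := inv pq.
  by exists (b' * c'); rewrite lmulset_invertible_setT.
- move=> [s [s_surj c'E]].
  have qb : (1 - c' * c) * b = 0.
    have : annl (b * s) (1 - c' * c) by rewrite -c'E.
    by rewrite annlM_surj.
  have pq := of_rideals qb (pc'_fact _ c'E).
  have [_ bE _ _] := fact pq; have [cb_inv _] := inv pq.
  by rewrite [in LHS]bE lmulsetM lmulset_invertible.
- move=> rE.
  have [u _ bE] : lmulset c' invertible b.
    by rewrite -rE; exists 1; rewrite ?mulr1 //; exact: invertible1.
  have [v _ c'E] : lmulset b invertible c'.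
    by rewrite rE; exists 1; rewrite ?mulr1 //; exact: invertible1.
  have pq := of_rideals (qb_fact _ (esym bE)) (pc'_fact _ (esym c'E)).
  have [cE _ _ _] := fact pq; have [cb_inv _] := inv pq.
  by rewrite [in LHS]cE rmulsetM rmulset_invertible.
- move=> lE.
  have [u _ cE] : rmulset invertible b' c.
    by rewrite -lE; exists 1; rewrite ?mul1r //; exact: invertible1.
  have [v _ b'E] : rmulset invertible c b'.
    by rewrite lE; exists 1; rewrite ?mul1r //; exact: invertible1.
  have pq := of_lideals (b'q_fact _ (esym b'E)) (cp_fact _ (esym cE)).
  have [{}cE bE _ _] := fact pq.
  (* Substitute [b = c' (c b)], respectively [c = (c b) b'], into [a = b c]. *)
  split; [exists (c * b * c) => //|exists (b * (c * b)) => //].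
    by rewrite a_bc [in RHS]bE !mulrA.
  by rewrite a_bc [in RHS]cE !mulrA.
- move=> [[s _ sE] [t _ tE]].
  (* Here [b = a c'] lies in [c' A] and [c = b' a] lies in [A b']. *)
  have qb : (1 - c' * c) * b = 0.
    by rewrite -[b]mulr1 -[X in b * X]cc' [b * _]mulrA -a_bc -sE
      !mulrA qc' !mul0r.
  have cp : c * (1 - b * b') = 0.
    by rewrite -[c]mul1r -[X in X * c]b'b -[b' * b * c]mulrA -a_bc -tE
      -!mulrA b'p !mulr0.
  have [_ _ b'E c'E] := fact (of_bc qb cp).
  split; [exists (b' * c' * b') => //|exists (c' * (b' * c')) => //].
    by rewrite a'E [in RHS]c'E !mulrA.
  by rewrite a'E [in RHS]b'E !mulrA.
(* From [a^dag = c' b'] one gets [b' = c a^dag] in [A c] and [c' = a^dag b] in [b A]. *)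
- move=> [[s _ sE] [t _ tE]]; apply/EPE/of_b'c'.
    by rewrite -[b']mul1r -[X in X * b']cc' -[c * c' * b']mulrA -a'E -tE
      -!mulrA cq !mulr0.
  by rewrite -[c']mulr1 -[X in c' * X]b'b [c' * _]mulrA -a'E -sE !mulrA pb !mul0r.
Qed.
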